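(* Let $2\le d\in\mathbb{N}$, $0<\epsilon<1$, let $\gamma\in\mathbb{R}$ satisfy $d-1<\gamma\le d$, and let $K>0$. Then there exists a constant $C_0\ge 1$, depending only on $K,\epsilon,\gamma,d$, such that the following holds. For every real pre-Hilbert space $H$ with $\dim(H)\ge d+1$, every $\gamma$-dimensional Ahlfors regular measure $\mu$ on $H$ with regularity constant $C_\mu=K$, every $w\in\mathrm{supp}(\mu)$, every $S=\{v_1,\dots,v_{d+1}\}\subseteq H$, and every $C\ge C_0$, $$\frac{\mu\left(U_C(S,w)\cap B(w,r)\right)}{\mu\left(B(w,r)\right)}\ge 1-\epsilon\quad\text{for all }0<r\le\mathrm{diam}(\mathrm{supp}(\mu)).$$
   Context: $B(x,r)=\{u\in H:\|u-x\|\le r\}$. The support $\mathrm{supp}(\mu)$ is the smallest closed set whose complement is $\mu$-null; $\mathrm{diam}$ denotes the (possibly infinite) diameter, and $r$ is always a finite real number. Ahlfors regularity: a locally finite Borel measure $\mu$ on $H$ is $\gamma$-dimensional Ahlfors regular if there is a constant $C$ such that $C^{-1}r^\gamma\le\mu(B(x,r))\le C r^\gamma$ for all $x\in\mathrm{supp}(\mu)$ and $0<r\le\mathrm{diam}(\mathrm{supp}(\mu))$. The smallest such $C$ is the regularity constant $C_\mu$. Polar sine: $|M_k(v_1,\dots,v_k)|=\left[\det\left(\{\langle v_i,v_j\rangle\}_{i,j=1}^k\right)\right]^{1/2}$, $|\mathrm{p}_d\mathrm{sin}_0(v_1,\dots,v_{d+1})|=\dfrac{|M_{d+1}(v_1,\dots,v_{d+1})|}{\prod_{j=1}^{d+1}\|v_j\|}$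 (value $0$ if the denominator is $0$), and $|\mathrm{p}_d\mathrm{sin}_w(v_1,\dots,v_{d+1})|=|\mathrm{p}_d\mathrm{sin}_0(v_1-w,\dots,v_{d+1}-w)|$. For $S=\{v_1,\dots,v_{d+1}\}$ (an indexed family), $w\in H$ and $C>0$, $U_C(S,w)$ is the set of all $u\in H$ such that for all $1\le i<j\le d+1$, $$|\mathrm{p}_d\mathrm{sin}_w(v_1,\dots,v_{d+1})|\le C\left(|\mathrm{p}_d\mathrm{sin}_w(v_1,\dots,v_{i-1},u,v_{i+1},\dots,v_{d+1})|+|\mathrm{p}_d\mathrm{sin}_w(v_1,\dots,v_{j-1},u,v_{j+1},\dots,v_{d+1})|\right).$$ *)

(* Defs.v *)
From HB Require Import structures.
From mathcomp Require Import all_boot all_order all_algebra.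
From mathcomp Require Import all_classical all_reals all_analysis.

Set Implicit Arguments.
Unset Strict Implicit.
Unset Printing Implicit Defensive.

Import Order.TTheory GRing.Theory Num.Theory.
Import numFieldNormedType.Exports.

Local Open Scope classical_set_scope.
Local Open Scope ring_scope.

(* A real pre-Hilbert space is a normed module [H] together with a real inner
   product [ip : {dot H for idfun}] (symmetric positive definite form) inducing
   the norm of [H]; [H] need be neither complete, separable nor
   finite-dimensional. *)
Definition induces_norm (R : realType) (H : normedModType R)
    (ip : {dot H for idfun}) : Prop :=
  forall u : H, `|u| = Num.sqrt (ip u u).

Definition dim_ge (R : realType) (H : lmodType R) (n : nat) : Prop :=
  exists e : 'I_n -> H, forall c : 'I_n -> R,
    \sum_(i < n) c i *: e i = 0 -> forall i, c i = 0.

Definition borelType (R : realType) (H : normedModType R) :=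
  g_sigma_algebraType (@open H).

Section AhlforsRegularity.
Variables (R : realType) (H : normedModType R).
Variable mu : {measure set (borelType H) -> \bar R}.

(* The closed ball {u | `|x - u| <= r}. *)
Definition cball (x : H) (r : R) : set H := closed_ball_ Num.norm x r.

Definition locally_finite : Prop :=
  forall x : H, exists U : set H, [/\ open U, U x & (mu U < +oo)%E].

(* "The smallest closed set with null complement" is a relation: on a
   non-separable space its existence is not a theorem, since the intersection
   of all closed sets with null complement could have a non-null complement. *)
Definition is_support (A : set H) : Prop :=
  [/\ closed A, mu (~` A) = 0%E &
      forall B : set H, closed B -> mu (~` B) = 0%E -> A `<=` B].

Definition diam (A : set H) : \bar R :=
  ereal_sup [set (`|p.1 - p.2|)%:E | p in A `*` A].

(* [A] stands for the support of [mu]. *)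
Definition ahlfors_constant (gamma : R) (A : set H) : set R :=
  [set C | 0 < C /\ forall (x : H) (r : R), A x -> 0 < r -> (r%:E <= diam A)%E ->
     ((C^-1 * r `^ gamma)%:E <= mu (cball x r))%E /\
     (mu (cball x r) <= (C * r `^ gamma)%:E)%E].

Definition ahlfors_regular (gamma : R) (A : set H) : Prop :=
  locally_finite /\ exists C, ahlfors_constant gamma A C.

Definition is_regularity_constant (gamma : R) (A : set H) (K : R) : Prop :=
  ahlfors_constant gamma A K /\ lbound (ahlfors_constant gamma A) K.

End AhlforsRegularity.

Section PolarSine.
Variables (R : realType) (H : normedModType R) (ip : {dot H for idfun}).

(* |M_k (v_1, ..., v_k)| *)
Definition gram_volume (k : nat) (v : 'I_k -> H) : R :=
  Num.sqrt (\det (\matrix_(i < k, j < k) ip (v i) (v j))).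

(* |p_d sin_0|; division by 0 yields 0. *)
Definition psin0 (d : nat) (v : 'I_d.+1 -> H) : R :=
  gram_volume v / \prod_(j < d.+1) `|v j|.

Definition psin (d : nat) (w : H) (v : 'I_d.+1 -> H) : R :=
  psin0 (fun i => v i - w).

(* U_C (S, w), for the indexed family S = (v_1, ..., v_{d+1}). *)
Definition Uset (d : nat) (C : R) (v : 'I_d.+1 -> H) (w : H) : set H :=
  [set u | forall i j : 'I_d.+1, (i < j)%N ->
     psin w v <= C * (psin w [eta v with i |-> u] + psin w [eta v with j |-> u])].

End PolarSine.

(* Main.v *)
Require Import Defs.
From HB Require Import structures.
From mathcomp Require Import all_boot all_order all_algebra.
From mathcomp Require Import all_classical all_reals all_analysis.
From mathcomp Require Import perm ring lra.

Set Implicit Arguments.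
Unset Strict Implicit.
Unset Printing Implicit Defensive.

Import Order.TTheory GRing.Theory Num.Theory.
Import numFieldNormedType.Exports.
Local Open Scope classical_set_scope.
Local Open Scope ring_scope.

(* Put [w] at the origin.  For [i < j] let [E] be the span of the [v_k] with
   [k <> i, j], and write [x'] for the component of [x] orthogonal to [E].  The
   Gram determinant of [v] factors as that of [(v_k)_(k <> i, j)] times the 2x2
   Gram determinant of [v_i', v_j'], and likewise when [v_i] or [v_j] is
   replaced by [u].  The triangle inequality for the sine of the angle, applied
   to [u', v_i', v_j'], then shows that a point [u] violating the inequality for
   [(i, j)] satisfies [|u'| <= |u| / C]: it lies in a thin tube around the
   [(d-1)]-plane [E].  Inside a ball of radius [r] this tube is covered by
   [O(M^(d-1))] balls of radius [O(r/M)], [M ~ C], each of measure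
   [O((r/M)^gamma)], so that its measure is [O(M^(d-1-gamma) r^gamma)], with
   negative exponent [d-1-gamma]. *)

(** * Inner-product identities and the triangle inequality for sines *)

Section InnerProduct.
Variables (R : realType) (H : normedModType R) (ip : {dot H for idfun}).
Hypothesis ip_norm : induces_norm ip.

Lemma ip_sym (x y : H) : ip x y = ip y x.
Proof. by rewrite (hermC ip) expr0 mul1r. Qed.

Lemma ip_sqr_norm (x : H) : ip x x = `|x| ^+ 2.
Proof.
rewrite ip_norm sqr_sqrtr //; have [->|x0] := eqVneq x 0; first by rewrite linear0l.
by rewrite ltW// neq0_dnorm_gt0.
Qed.

Lemma ip_addr (x y z : H) : ip z (x + y) = ip z x + ip z y.
Proof. exact: linearDr. Qed.

Lemma ip_subl (x y z : H) : ip (x - y) z = ip x z - ip y z.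
Proof. exact: linearBl. Qed.

Lemma ip_subr (x y z : H) : ip z (x - y) = ip z x - ip z y.
Proof. exact: linearBr. Qed.

Lemma ip_scalel (a : R) (x y : H) : ip (a *: x) y = a * ip x y.
Proof. exact: linearZl_LR. Qed.

Lemma ip_scaler (a : R) (x y : H) : ip x (a *: y) = a * ip x y.
Proof. by rewrite ip_sym ip_scalel ip_sym. Qed.

Lemma ip_suml (n : nat) (c : 'I_n -> R) (e : 'I_n -> H) (x : H) :
  ip (\sum_i c i *: e i) x = \sum_i c i * ip (e i) x.
Proof.
rewrite (big_morph (fun y => ip y x) (id1 := 0) (op1 := +%R)).
- by apply: eq_bigr => i _; rewrite ip_scalel.
- by move=> a b; rewrite linearDl.
- by rewrite linear0l.
Qed.

Lemma ip_sumr (n : nat) (c : 'I_n -> R) (e : 'I_n -> H) (x : H) :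
  ip x (\sum_i c i *: e i) = \sum_i c i * ip x (e i).
Proof. by rewrite ip_sym ip_suml; apply: eq_bigr => i _; rewrite ip_sym. Qed.

(** The squared area of the parallelogram on [x] and [y]; its square root is [|x| |y|] times the
    sine of their angle. *)
Definition gram2 (x y : H) : R := ip x x * ip y y - ip x y ^+ 2.

(* For [x = 0] the inverse is [0], so that [reject 0] is the identity. *)
Definition reject (x y : H) : H := y - (ip x y / ip x x) *: x.

Lemma reject_linear (x u z : H) (a : R) :
  reject x (a *: u + z) = a *: reject x u + reject x z.
Proof.
rewrite /reject ip_addr ip_scaler mulrDl -mulrA scalerDl scalerBr scalerA.
by rewrite opprD addrACA.
Qed.

Lemma gram2_sym (x y : H) : gram2 x y = gram2 y x.
Proof. by rewrite /gram2 (ip_sym x y) (mulrC (ip x x)). Qed.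

(** Area is base times height. Nonnegativity of [gram2], and with it Cauchy-Schwarz, follows. *)
Lemma gram2_reject (x y : H) : gram2 x y = (`|x| * `|reject x y|) ^+ 2.
Proof.
rewrite exprMn -!ip_sqr_norm /gram2 /reject.
rewrite !(ip_subl, ip_subr, ip_scalel, ip_scaler) (ip_sym y x).
have [->|x0] := eqVneq x 0; first by rewrite !(linear0l ip); ring.
have : ip x x != 0 by rewrite gt_eqF// neq0_dnorm_gt0.
by move=> ?; field.
Qed.

Lemma sqrt_gram2 (x y : H) : Num.sqrt (gram2 x y) = `|x| * `|reject x y|.
Proof. by rewrite gram2_reject sqrtr_sqr ger0_norm// mulr_ge0. Qed.

Lemma gram2_ge0 (x y : H) : 0 <= gram2 x y.
Proof. by rewrite gram2_reject sqr_ge0. Qed.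

Lemma cauchy_schwarz (x y : H) : `|ip x y| <= `|x| * `|y|.
Proof.
rewrite -(@ler_pXn2r _ 2) ?nnegrE ?mulr_ge0// exprMn -!ip_sqr_norm.
by rewrite real_normK ?num_real// -subr_ge0 gram2_ge0.
Qed.

Lemma norm_reject_le (x y : H) : `|reject x y| <= `|y|.
Proof.
have [->|x0] := eqVneq x 0; first by rewrite /reject scaler0 subr0.
rewrite -(@ler_pM2l _ `|x|) ?normr_gt0//.
rewrite -(@ler_pXn2r _ 2) ?nnegrE ?mulr_ge0// -gram2_reject /gram2.
by rewrite exprMn -!ip_sqr_norm gerBl sqr_ge0.
Qed.

(* Splitting [y] along [u] and using that [z |-> sqrt (gram2 x z)] is a
   seminorm bounded by [|x| |z|]. *)
Lemma sine_triangle (u x y : H) :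
  `|u| * Num.sqrt (gram2 x y) <=
  `|x| * Num.sqrt (gram2 u y) + `|y| * Num.sqrt (gram2 x u).
Proof.
rewrite !sqrt_gram2; have [->|u0] := eqVneq u 0.
  by rewrite normr0 mul0r addr_ge0// !mulr_ge0.
set b := ip u y / ip u u.
have Ey : reject x y = b *: reject x u + reject x (reject u y).
  by rewrite -reject_linear [_ + reject u y]addrC subrK.
have bu : `|u| * `|b| <= `|y|.
  rewrite /b normrM normrV ?unitfE ?gt_eqF ?neq0_dnorm_gt0//.
  rewrite ip_sqr_norm normrX normr_id mulrA ler_pdivrMr ?exprn_gt0 ?normr_gt0//.
  rewrite [leRHS](_ : _ = `|u| * (`|u| * `|y|)); last by ring.
  by rewrite ler_wpM2l ?cauchy_schwarz.
have q := norm_reject_le x (reject u y).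
rewrite Ey; apply: (@le_trans _ _ (`|u| * (`|x| * (`|b| * `|reject x u| + `|reject u y|)))).
  do 2!apply: ler_wpM2l => //.
  by rewrite (le_trans (ler_normD _ _))// normrZ lerD2l.
rewrite !mulrDr addrC lerD//; first by rewrite mulrCA.
rewrite [leLHS](_ : _ = `|u| * `|b| * (`|x| * `|reject x u|)); last by ring.
by apply: ler_wpM2r bu; rewrite mulr_ge0.
Qed.

(** * Components orthogonal to a span, and factorisation of Gram determinants *)

Definition residual {n : nat} (f : 'I_n -> H) (x : H) : H :=
  x - \sum_k ip x (f k) *: f k.

(* [f] is orthonormal except for zero vectors, which arise when [e] is linearly
   dependent. *)
Lemma gram_schmidt (n : nat) (e : 'I_n -> H) : exists f : 'I_n -> H,
  [/\ forall k, `|f k| <= 1,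
      forall x, exists c : 'I_n -> R, residual f x = x - \sum_k c k *: e k &
      forall x k, ip (residual f x) (e k) = 0].
Proof.
elim: n e => [|n IHn] e.
  exists e; split => [[]//|x|x []//]; exists (fun=> 0).
  by rewrite /residual !big_ord0.
have [f [f1 fspan forth]] := IHn (fun k => e (lift ord0 k)).
(* The tail is already orthogonalised; [q] is the new direction that [e ord0] brings. If it brings
   none, [q] and [f0] are zero. *)
set q := residual f (e ord0); set f0 := `|q|^-1 *: q.
have qe k : ip q (e (lift ord0 k)) = 0 by exact: forth.
have resq x : ip (residual f x) q = ip x q.
  have [c cE] := fspan x.
  rewrite cE ip_subl ip_suml big1 ?subr0// => k _.
  by rewrite ip_sym qe mulr0.
exists (fun i => oapp f f0 (unlift ord0 i)).
have resE x : residual (fun i => oapp f f0 (unlift ord0 i)) x =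
    residual f x - ip x f0 *: f0.
  rewrite /residual big_ord_recl unlift_none /= opprD addrA addrAC.
  by under eq_bigr do rewrite liftK.
have f0E x : ip x f0 *: f0 = (ip x q / `|q| ^+ 2) *: q.
  rewrite /f0 ip_scaler scalerA; congr (_ *: _).
  by rewrite -exprVn; ring.
split.
- move=> k; case: unliftP => [j _|_] //=.
  rewrite /f0 normrZ normfV normr_id.
  have [->|q0] := eqVneq q 0; first by rewrite normr0 mulr0.
  by rewrite mulVf// normr_eq0.
- move=> x; have [c cE] := fspan x; have [b bE] := fspan (e ord0).
  exists (fun i => oapp (fun j => c j - ip x q / `|q| ^+ 2 * b j)
                        (ip x q / `|q| ^+ 2) (unlift ord0 i)).
  rewrite resE f0E cE big_ord_recl unlift_none /=.
  under [in RHS]eq_bigr do rewrite liftK /= scalerBl -scalerA.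
  rewrite sumrB -scaler_sumr /q bE scalerBr.
  by rewrite !opprD !opprK !addrA; congr (_ + _); rewrite addrAC.
- move=> x k; rewrite resE ip_subl f0E ip_scalel.
  case: (unliftP ord0 k) => [j ->|->]; first by rewrite forth qe mulr0 subr0.
  (* Such a [z] pairs alike with [e ord0] and [q], which differ by a combination of the tail. *)
  have ipe0 z : (forall j, ip z (e (lift ord0 j)) = 0) -> ip z (e ord0) = ip z q.
    have [b bE] := fspan (e ord0); move=> zorth.
    by rewrite /q bE ip_subr ip_sumr big1 ?subr0// => j _; rewrite zorth mulr0.
  rewrite !ipe0// resq ip_sqr_norm.
  have [->|q0] := eqVneq q 0; first by rewrite linear0r mul0r mul0r subr0.
  by rewrite divfK ?subrr// expf_neq0// normr_eq0.
Qed.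

(** Block elimination: left multiplication by the unitriangular [T] replaces [w i] by [Q (w i)] in
    the first [m] rows. By orthogonality the upper right block then vanishes. *)
Lemma det_gram_residual (m n : nat) (w : 'I_(m + n) -> H) (Q : H -> H) :
  (forall x, exists c : 'I_n -> R, Q x = x - \sum_k c k *: w (rshift m k)) ->
  (forall x k, ip (Q x) (w (rshift m k)) = 0) ->
  \det (\matrix_(i, j) ip (w i) (w j)) =
  \det (\matrix_(i < m, j < m) ip (Q (w (lshift n i))) (Q (w (lshift n j)))) *
  \det (\matrix_(i < n, j < n) ip (w (rshift m i)) (w (rshift m j))).
Proof.
move=> Qspan Qorth.
have [N NE] : {N : 'M[R]_(m, n) | forall i,
    Q (w (lshift n i)) = w (lshift n i) - \sum_k N i k *: w (rshift m k)}.
  have [c cE] := choice Qspan.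
  exists (\matrix_(i, k) c (w (lshift n i)) k) => i.
  by rewrite cE; congr (_ - _); apply: eq_bigr => k _; rewrite mxE.
set G := \matrix_(i, j) ip (w i) (w j).
pose T := block_mx 1%:M (- N) 0 (1%:M : 'M[R]_n).
have detT : \det T = 1 by rewrite det_ublock !det1 mulr1.
rewrite -[LHS]mul1r -detT -det_mulmx -[G]submxK mulmx_block.
rewrite !mul1mx !mul0mx !add0r.
have -> : ursubmx G + - N *m drsubmx G = 0.
  apply/matrixP => i k; rewrite !mxE; under eq_bigr do rewrite !mxE mulNr.
  by rewrite sumrN -ip_suml -ip_subl -NE Qorth.
rewrite det_lblock.
(* Elimination leaves [ip (Q (w i)) (w j)]. Here [w j] may become [Q (w j)]: their difference is a
   combination of the last [n] vectors, orthogonal to [Q (w i)]. *)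
have -> : ulsubmx G + - N *m dlsubmx G =
    \matrix_(i, j) ip (Q (w (lshift n i))) (Q (w (lshift n j))).
  apply/matrixP => i j; rewrite !mxE; under eq_bigr do rewrite !mxE mulNr.
  rewrite sumrN -ip_suml -ip_subl -NE [in RHS](NE j) ip_subr ip_sumr.
  by rewrite [X in _ - X]big1 ?subr0// => k _; rewrite Qorth mulr0.
by congr (_ * \det _); apply/matrixP => i j; rewrite !mxE.
Qed.

(** Rows and columns undergo the same permutation, so its sign enters squared. *)
Lemma det_gram_perm (n : nat) (s : 'S_n) (v : 'I_n -> H) :
  \det (\matrix_(i, j) ip (v (s i)) (v (s j))) = \det (\matrix_(i, j) ip (v i) (v j)).
Proof.
rewrite (_ : \matrix_(i, j) _ = row_perm s (col_perm s (\matrix_(i, j) ip (v i) (v j)))).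
  rewrite row_permE col_permE !det_mulmx !det_perm odd_permV mulrC -mulrA.
  by rewrite -expr2 sqrr_sign mulr1.
by apply/matrixP => i j; rewrite !mxE.
Qed.

Lemma det_gram2 (z : 'I_2 -> H) :
  \det (\matrix_(i, j) ip (z i) (z j)) = gram2 (z 0) (z 1).
Proof.
rewrite (expand_det_row _ 0) !big_ord_recl big_ord0 addr0 /cofactor !det_mx11 !mxE /=.
have l0 : lift 0 0 = 1 :> 'I_2 by exact: val_inj.
have l1 : lift 1 0 = 0 :> 'I_2 by exact: val_inj.
rewrite ?l0 ?l1 /gram2 (ip_sym (z 1) (z 0)) /= expr0 expr1; ring.
Qed.

(** Orthogonality makes the squared norm of [residual f x] equal to [ip (residual f x) x];
    Cauchy-Schwarz concludes. *)
Lemma norm_residual (n : nat) (e f : 'I_n -> H) (x : H) :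
  (exists c : 'I_n -> R, residual f x = x - \sum_k c k *: e k) ->
  (forall k, ip (residual f x) (e k) = 0) -> `|residual f x| <= `|x|.
Proof.
move=> [c cE] orth; have [->|Q0] := eqVneq (residual f x) 0; first by rewrite normr0.
rewrite -(@ler_pM2l _ `|residual f x|) ?normr_gt0// -expr2 -ip_sqr_norm.
rewrite {2}cE ip_subr ip_sumr big1 ?subr0; last by move=> k _; rewrite orth mulr0.
by rewrite (le_trans (ler_norm _))// cauchy_schwarz.
Qed.

(** Presents [v] and both of its replacements by [u] as values of one function of the vectors in
    slots [i] and [j]. *)
Definition two_points {n : nat} (v : 'I_n -> H) (i j : 'I_n) (x y : H) (k : 'I_n) : H :=
  if k == i then x else if k == j then y else v k.

Lemma perm01 (n : nat) (i j : 'I_n.+2) : i != j ->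
  exists s : {perm 'I_n.+2}, s 0 = i /\ s 1 = j.
Proof.
(* The left factor acts first: it fixes 0 and sends 1 to the preimage of [j] under [t]. *)
move=> ij; pose t := tperm 0 i; exists (tperm 1%R (t^-1 j) * t)%g.
have tj : (t^-1)%g j != 0.
  by apply: contra_neq ij => tj0; rewrite -(permKV t j) tj0 tpermL.
split; rewrite permM; last by rewrite tpermL permKV.
by rewrite (@tpermD _ 1 (t^-1 j)%g 0)// tpermL.
Qed.

(** Slots [i] and [j] are permuted to the front and the determinant is factored: [D] is the volume
    of the other vectors and [f] their Gram-Schmidt family. Neither depends on [x], [y], so the
    three polar sines become comparable. *)
Lemma gram_volume_two_points (n : nat) (v : 'I_n.+2 -> H) (i j : 'I_n.+2) :
  i != j -> exists (f : 'I_n -> H) (D : R),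
  [/\ 0 <= D, forall k, `|f k| <= 1, forall x, `|residual f x| <= `|x| &
      forall x y, gram_volume ip (two_points v i j x y) =
        D * Num.sqrt (gram2 (residual f x) (residual f y))].
Proof.
move=> /perm01[s [s0 s1]].
pose e (k : 'I_n) := v (s (rshift 2 k)).
have [f [f1 fspan forth]] := gram_schmidt e.
exists f, (Num.sqrt (\det (\matrix_(k, l) ip (e k) (e l)))); split => //.
  by move=> x; apply: norm_residual (forth x).
move=> x y; rewrite /gram_volume -(det_gram_perm s).
set w := fun k => two_points v i j x y (s k).
have we k : w (rshift 2 k) = e k.
  by rewrite /w /two_points -s0 -s1 !(inj_eq perm_inj).
rewrite (@det_gram_residual 2 n w (residual f)); first last.
- by move=> z k; rewrite we.
- by move=> z; have [c cE] := fspan z; exists c; under eq_bigr do rewrite we.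
rewrite (_ : \matrix_(k, l) ip (w (rshift 2 k)) (w (rshift 2 l)) =
  \matrix_(k, l) ip (e k) (e l)); last by apply/matrixP => k l; rewrite !mxE !we.
rewrite det_gram2 sqrtrM ?gram2_ge0// mulrC; congr (_ * Num.sqrt (gram2 _ _)).
  by rewrite /w /two_points (_ : lshift n 0 = 0) ?s0 ?eqxx//; exact/val_inj.
rewrite /w /two_points (_ : lshift n 1 = 1) ?s1; last exact/val_inj.
by rewrite -s1 -s0 (inj_eq perm_inj)/= eqxx.
Qed.

Lemma psin_two_points (n : nat) (w : H) (v : 'I_n.+2 -> H) (i j : 'I_n.+2) :
  i != j -> exists (f : 'I_n -> H) (D : R),
  [/\ 0 <= D, forall k, `|f k| <= 1, forall x, `|residual f x| <= `|x| &
      forall x y, psin ip w (two_points v i j x y) =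
        D * Num.sqrt (gram2 (residual f (x - w)) (residual f (y - w))) /
        (`|x - w| * `|y - w|)].
Proof.
move=> ij.
have [f [D [D0 f1 fn fE]]] := gram_volume_two_points (fun k => v k - w) ij.
(* The norms common to all replacements. If [P = 0], both sides are 0 by the convention for division
   by 0. *)
pose P := \prod_(k < n.+2 | (k != i) && (k != j)) `|v k - w|.
exists f, (D / P); split => // [|x y].
  by rewrite divr_ge0 ?prodr_ge0.
have E : (fun k => two_points v i j x y k - w) =
    two_points (fun k => v k - w) i j (x - w) (y - w).
  by apply/funext => k; rewrite /two_points; do 2?case: ifP.
rewrite /psin /psin0 E fE.
rewrite (bigD1 i)//= (bigD1 j) 1?eq_sym//= /two_points eqxx (negbTE (_ : j != i)) 1?eq_sym// eqxx.
rewrite (eq_bigr (fun k => `|v k - w|)) => [|k /andP[/negbTE-> /negbTE->]//].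
by rewrite -/P !invfM; ring.
Qed.

(** * Points violating one inequality: measurability and the tube *)

Lemma residualB (n : nat) (f : 'I_n -> H) (x y : H) :
  residual f (x - y) = residual f x - residual f y.
Proof.
rewrite /residual; under eq_bigr do rewrite ip_sym ip_subr scalerBl !(ip_sym (f _)).
by rewrite sumrB !opprB [X in _ + X = _]addrC addrACA [- y + _]addrC.
Qed.

Lemma rejectB (x y z : H) : reject x (y - z) = reject x y - reject x z.
Proof.
by rewrite -scaleN1r addrC reject_linear scaleN1r addrC.
Qed.

Lemma nonexpansive_continuous (g : H -> H) :
  (forall x y, `|g x - g y| <= `|x - y|) -> continuous g.
Proof.
move=> gn x; apply/cvgrPdist_lt => e e0; near=> y.
by rewrite (le_lt_trans (gn _ _))//; near: y; apply: cvgr_dist_lt.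
Unshelve. all: by end_near. Qed.

(** By [sqrt_gram2] this is a constant times the norm of a nonexpansive map. *)
Lemma continuous_sqrt_gram2_residual (n : nat) (f : 'I_n -> H) (x w : H) :
  (forall x, `|residual f x| <= `|x|) ->
  continuous (fun u => Num.sqrt (gram2 x (residual f (u - w)))).
Proof.
move=> fn; rewrite (_ : (fun u => _) = fun u => `|x| * `|reject x (residual f (u - w))|).
  move=> u; apply: cvgMr; apply: cvg_norm; move: u; apply: nonexpansive_continuous => u1 u2.
  rewrite -rejectB (le_trans (norm_reject_le _ _))// -residualB (le_trans (fn _))//.
  by rewrite opprB addrA subrK.
by apply/funext => u; rewrite sqrt_gram2.
Qed.

Definition bad_pair (n : nat) (C : R) (v : 'I_n.+2 -> H) (w : H) (i j : 'I_n.+2) : set H :=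
  [set u | C * (psin ip w [eta v with i |-> u] + psin ip w [eta v with j |-> u]) < psin ip w v].

Lemma open_borel (A : set (borelType H)) : open (A : set H) -> measurable A.
Proof. by move=> Aopen; exact: sub_sigma_algebra. Qed.

Lemma closed_borel (A : set (borelType H)) : closed (A : set H) -> measurable A.
Proof.
move=> Aclosed; rewrite -[A]setCK; apply: measurableC; apply: open_borel.
exact: closed_openC.
Qed.

(** With denominators cleared, a violation bounds [C] times the right side of [sine_triangle],
    applied to the residuals of [u - w], [x], [y], by the area of the residuals of [x], [y] times
    [|u - w|]. Cancelling that area leaves the tube bound. *)
Lemma bad_pair_tube (n : nat) (w : H) (v : 'I_n.+2 -> H) (i j : 'I_n.+2) :
  i != j -> exists f : 'I_n -> H,
  [/\ forall k, `|f k| <= 1, forall x, `|residual f x| <= `|x| &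
   forall C, 0 < C ->
     measurable (bad_pair C v w i j : set (borelType H)) /\
     forall u, bad_pair C v w i j u -> `|residual f (u - w)| <= `|u - w| / C].
Proof.
move=> ij; have [f [D [D0 f1 fn fE]]] := psin_two_points w v ij.
exists f; split => // C C0.
set x := v i - w; set y := v j - w; set Q := residual f in fn fE *.
have vE : psin ip w v = D * Num.sqrt (gram2 (Q x) (Q y)) / (`|x| * `|y|).
  rewrite -fE; congr psin; apply/funext => k; rewrite /two_points.
  by case: eqP => [->//|_]; case: eqP => [->|].
have viE u : psin ip w [eta v with i |-> u] =
    D * Num.sqrt (gram2 (Q (u - w)) (Q y)) / (`|u - w| * `|y|).
  rewrite -fE; congr psin; apply/funext => k; rewrite /two_points /=.
  by case: eqP => // _; case: eqP => [->|].
have vjE u : psin ip w [eta v with j |-> u] =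
    D * Num.sqrt (gram2 (Q x) (Q (u - w))) / (`|x| * `|u - w|).
  rewrite -fE; congr psin; apply/funext => k; rewrite /two_points /=.
  by case: eqP => [->|_]; [rewrite eq_sym (negbTE ij)|case: eqP => [->|]].
(* A violation forces the polar sine of [v] to be positive, which makes [D], [|x|] and [|y|] nonzero
   and lets them be cancelled. *)
have bad0 u : bad_pair C v w i j u -> 0 < psin ip w v.
  apply: le_lt_trans; rewrite mulr_ge0 ?(ltW C0)// addr_ge0// /psin /psin0 /gram_volume.
    by rewrite divr_ge0 ?sqrtr_ge0// prodr_ge0.
  by rewrite divr_ge0 ?sqrtr_ge0// prodr_ge0.
have [s0|s0] := leP (psin ip w v) 0.
  have bad_pair0 : bad_pair C v w i j = set0.
    by rewrite -subset0 => u /bad0; rewrite ltNge s0.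
  by rewrite bad_pair0; split.
have D_gt0 : 0 < D.
  by rewrite lt_def D0 andbT; apply: contraTneq s0 => D00; rewrite vE D00 !mul0r ltxx.
have x0 : 0 < `|x|.
  by rewrite normr_gt0; apply: contraTneq s0 => x00; rewrite vE x00 normr0 mul0r invr0 mulr0 ltxx.
have y0 : 0 < `|y|.
  by rewrite normr_gt0; apply: contraTneq s0 => y00; rewrite vE y00 normr0 mulr0 invr0 mulr0 ltxx.
(* The inequality multiplied by [|x| |y| |u - w| / D]: continuous in [u], hence suited to
   measurability. *)
pose phi u := C * (`|x| * Num.sqrt (gram2 (Q y) (Q (u - w))) +
  `|y| * Num.sqrt (gram2 (Q x) (Q (u - w)))) - Num.sqrt (gram2 (Q x) (Q y)) * `|u - w|.
have phiE u : u != w -> bad_pair C v w i j u <-> phi u < 0.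
  rewrite -subr_eq0 -normr_gt0 => z0.
  rewrite /bad_pair /= vE viE vjE -(@ltr_pM2r _ (`|x| * `|y| * `|u - w| / D)); last first.
    by rewrite divr_gt0// !mulr_gt0.
  rewrite /phi subr_lt0 (gram2_sym (Q y)).
  rewrite [X in _ < X <-> _](_ : _ = Num.sqrt (gram2 (Q x) (Q y)) * `|u - w|); last first.
    by field; rewrite ?gt_eqF.
  rewrite [X in X < _ <-> _](_ : _ = C * (`|x| * Num.sqrt (gram2 (Q (u - w)) (Q y)) +
  `|y| * Num.sqrt (gram2 (Q x) (Q (u - w)))))//.
  by field; rewrite ?gt_eqF.
have phi_cont : continuous phi.
  move=> u; apply: cvgB; last first.
    by apply: cvgMr; apply: cvg_norm; apply: cvgB => //; exact: cvg_cst.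
  apply: cvgMr; apply: cvgD; apply: cvgMr; exact: continuous_sqrt_gram2_residual.
(* The point [w] is apart: both replaced polar sines are 0 there by convention, so [w] is bad
   although [phi w >= 0]. *)
have badE : bad_pair C v w i j = [set w] `|` phi @^-1` [set t | t < 0].
  apply/seteqP; split => [u bad|u /= [->|]].
  - have [->|uw] := eqVneq u w; [by left|right].
    exact/phiE.
  - by rewrite /bad_pair /= viE vjE subrr normr0 mul0r mulr0 invr0 !mulr0 addr0 mulr0.
  - have [->|uw] := eqVneq u w; last by move/(phiE _ uw).
    by rewrite /phi subrr normr0 mulr0 subr0 ltNge mulr_ge0 ?(ltW C0)// addr_ge0// mulr_ge0// sqrtr_ge0.
split.
  rewrite badE; apply: measurableU.
    by apply: closed_borel; apply: accessible_closed_set1; exact/hausdorff_accessible/norm_hausdorff.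
  by apply: open_borel; apply: open_comp => // *; exact: phi_cont.
move=> u; have [->|uw] := eqVneq u w.
  move=> _; rewrite subrr normr0 mul0r -[leRHS](normr0 H); exact: fn.
move=> /(phiE _ uw); rewrite subr_lt0 => lt_phi.
have tri := sine_triangle (Q (u - w)) (Q x) (Q y).
have a0 : 0 < Num.sqrt (gram2 (Q x) (Q y)).
  rewrite lt_def sqrtr_ge0 andbT; apply: contraTneq lt_phi => ->.
  by rewrite mul0r -leNgt mulr_ge0 ?(ltW C0)// addr_ge0// mulr_ge0// sqrtr_ge0.
rewrite ler_pdivlMr// -(ler_pM2r a0) ltW// [ltRHS]mulrC.
apply: le_lt_trans lt_phi; rewrite -mulrA mulrCA ler_pM2l//.
rewrite (le_trans tri)// (gram2_sym (Q y)) lerD// ler_wpM2r ?sqrtr_ge0//; exact: fn.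
Qed.

(** * Covering the tube by balls centred on a grid *)

Definition grid_point (n : nat) (f : 'I_n -> H) (M : nat) (r : R)
    (g : {ffun 'I_n -> 'I_(2 * M).+1}) : H :=
  \sum_k ((g k)%:R * (r / M%:R) - r) *: f k.

(** Each coordinate lies in [[-r, r]] by Cauchy-Schwarz. Rounding it down to the grid of step
    [r / M] costs at most one step per axis. *)
Lemma grid_cover (n : nat) (f : 'I_n -> H) (M : nat) (r : R) (z : H) :
  (0 < M)%N -> 0 < r -> (forall k, `|f k| <= 1) -> `|z| <= r ->
  exists g : {ffun 'I_n -> 'I_(2 * M).+1},
    `|\sum_k ip z (f k) *: f k - grid_point f r g| <= n%:R * (r / M%:R).
Proof.
move=> M0 r0 f1 zr.
have M0' : 0 < M%:R :> R by rewrite ltr0n.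
have t0 : 0 < r / M%:R by rewrite divr_gt0.
(* The coordinate measured from [-r] in grid steps; it lies in [[0, 2M]], whence [2M + 1] values per
   axis. *)
pose q k := (ip z (f k) + r) / (r / M%:R).
have ipr k : `|ip z (f k)| <= r.
  rewrite (le_trans (cauchy_schwarz _ _))//.
  by rewrite -[leRHS]mulr1 ler_pM.
have q0 k : 0 <= q k.
  rewrite /q divr_ge0 ?(ltW t0)//.
  by have := ipr k; rewrite ler_norml => /andP[+ _]; rewrite -subr_ge0 opprK.
have qM k : (Num.trunc (q k) < (2 * M).+1)%N.
  rewrite truncn_lt_nat// /q ltr_pdivrMr//.
  have -> : (2 * M).+1%:R * (r / M%:R) = 2 * r + r / M%:R.
    by rewrite -natr1 natrM; field; rewrite gt_eqF.
  have := ipr k; rewrite ler_norml => /andP[_ ub].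
  by lra.
exists [ffun k => Ordinal (qM k)].
rewrite /grid_point -sumrB (le_trans (ler_norm_sum _ _ _))//.
rewrite [leRHS](_ : _ = \sum_(k < n) (r / M%:R)); last first.
  by rewrite sumr_const card_ord mulr_natl.
apply: ler_sum => k _.
rewrite ffunE /= -scalerBl normrZ -[leRHS]mulr1 ler_pM//.
have /andP[lb ub] := truncn_itv (q0 k).
have qE : ip z (f k) = q k * (r / M%:R) - r by rewrite divfK ?gt_eqF// addrK.
rewrite qE opprB addrA subrK -mulrBl normrM (gtr0_norm t0) -[leRHS]mul1r.
rewrite ler_pM2r// ger0_norm ?subr_ge0// lerBlDl.
by rewrite natr1 ltW.
Qed.

(** The residual of [u - w] contributes [r / C <= r / M] and the rounding of its projection [n]
    steps, in total [n + 1] steps. *)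
Lemma bad_pair_cover (n : nat) (w : H) (v : 'I_n.+2 -> H) (i j : 'I_n.+2) :
  i != j -> exists f : 'I_n -> H, forall (M : nat) (C r : R),
    (0 < M)%N -> M%:R <= C -> 0 < r ->
    bad_pair C v w i j `&` cball w r `<=`
      \bigcup_(g : {ffun 'I_n -> 'I_(2 * M).+1})
        cball (w + grid_point f r g) (n.+1%:R * (r / M%:R)).
Proof.
move=> ij; have [f [f1 fn tube]] := bad_pair_tube w v ij.
exists f => M C r M0 MC r0 u [ubad wr].
have M0' : 0 < M%:R :> R by rewrite ltr0n.
have C0 : 0 < C by exact: lt_le_trans MC.
have zr : `|u - w| <= r by rewrite distrC.
have [g gP] := grid_cover M0 r0 f1 zr; exists g => //.
rewrite /cball /closed_ball_ /= distrC.
have -> : u - (w + grid_point f r g) = residual f (u - w) +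
    (\sum_k ip (u - w) (f k) *: f k - grid_point f r g).
  by rewrite /residual addrA subrK opprD addrA.
rewrite (le_trans (ler_normD _ _))// -natr1 mulrDl mul1r addrC lerD//.
have [_ tubeC] := tube C C0.
rewrite (le_trans (tubeC u ubad))// ler_pM ?invr_ge0 ?(ltW C0)//.
by rewrite lef_pV2.
Qed.

Lemma measurable_bad_pair (n : nat) (C : R) (w : H) (v : 'I_n.+2 -> H) (i j : 'I_n.+2) :
  i != j -> 0 < C -> measurable (bad_pair C v w i j : set (borelType H)).
Proof.
by move=> ij C0; have [f [_ _ /(_ C C0)[]]] := bad_pair_tube w v ij.
Qed.

Lemma UsetC (d : nat) (C : R) (v : 'I_d.+2 -> H) (w : H) :
  ~` Uset ip C v w = \bigcup_(p in [set p : 'I_d.+2 * 'I_d.+2 | (p.1 < p.2)%N])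
    bad_pair C v w p.1 p.2.
Proof.
apply/seteqP; split => [u /existsNP[i /existsNP[j /not_implyP[ij /negP]]]|u [[i j] ij]].
  by rewrite -ltNge => bad; exists (i, j).
by rewrite /bad_pair /= ltNge => /negP bad U; apply: bad; exact: U.
Qed.

End InnerProduct.

(** * Measure estimates and the choice of the constant *)

Lemma measure_finite_cover d (T : measurableType d) (R : realType)
    (mu : {measure set T -> \bar R}) (I : finType) (F : I -> set T) (A : set T) (c : R) :
  measurable A -> (forall i, measurable (F i)) -> A `<=` \bigcup_i F i ->
  (forall i, mu (F i) <= c%:E)%E -> (mu A <= (#|I|%:R * c)%:E)%E.
Proof.
move=> mA mF AF muF.
have muU (s : seq I) : (mu (\big[setU/set0]_(i <- s) F i) <= ((size s)%:R * c)%:E)%E.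
  elim: s => [|i s IHs]; first by rewrite big_nil measure0 mul0r.
  rewrite big_cons /= (le_trans (measureU2 _ _ _))//; first exact: bigsetU_measurable.
  by rewrite -nat1r mulrDl mul1r EFinD leeD ?muF.
rewrite cardE; apply: le_trans (muU _).
apply: le_measure; rewrite ?inE//; first exact: bigsetU_measurable.
move=> x /AF[i _ Fix]; rewrite -bigcup_seq; exists i => //=.
by rewrite mem_enum.
Qed.

(** Grid centres may lie off the support, where regularity says nothing. A ball meeting the support
    at [x] sits in the ball of radius [2 r] about [x]; any other ball is null. *)
Lemma measure_cball_le (R : realType) (H : normedModType R)
    (mu : {measure set (borelType H) -> \bar R}) (supp : set H) (gamma K : R)
    (c : H) (r : R) :
  is_support mu supp -> ahlfors_constant mu gamma supp K ->
  0 < r -> ((2 * r)%:E <= diam supp)%E ->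
  (mu (cball c r) <= (K * (2 * r) `^ gamma)%:E)%E.
Proof.
move=> [supp_closed supp0 _] [K0 HK] r0 rdiam.
have mball x s : measurable (cball x s : set (borelType H)).
  by apply: closed_borel; exact: closed_closed_ball_.
have mC : measurable (~` supp : set (borelType H)).
  by apply: measurableC; exact: closed_borel.
have [[x [cx xsupp]]|empty] := pselect (exists x, cball c r x /\ supp x).
  have r20 : 0 < 2 * r by rewrite mulr_gt0.
  have [_ ub] := HK x (2 * r) xsupp r20 rdiam.
  apply: le_trans ub; apply: le_measure; rewrite ?inE// => y cy.
  move: cx cy; rewrite /cball /closed_ball_ /= => cx cy.
  have -> : x - y = - (c - x) + (c - y) by rewrite opprB addrA subrK.
  by rewrite (le_trans (ler_normD _ _))// normrN mulr_natl mulr2n lerD.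
apply: (@le_trans _ _ (mu (~` supp))).
  apply: le_measure; rewrite ?inE// => y cy ysupp.
  by apply: empty; exists y.
by rewrite supp0 lee_fin mulr_ge0 ?(ltW K0)// powR_ge0.
Qed.

(** The left side is at most a constant times [M] to the power [n - gamma < 0]. The target is
    [eps / K] because a ball of radius [r] may have measure as small as [r ^ gamma / K]. *)
Lemma tube_constant (R : realType) (n : nat) (eps gamma K : R) :
  0 < eps -> n%:R < gamma -> 0 < K ->
  exists M : nat, [/\ (0 < M)%N, 2 * n.+1%:R <= M%:R :> R &
    #|{: 'I_n.+2 * 'I_n.+2}|%:R * (#|{ffun 'I_n -> 'I_(2 * M).+1}|%:R *
      (K * (2 * (n.+1%:R / M%:R)) `^ gamma)) <= eps / K].
Proof.
move=> eps0 ngamma K0.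
pose c := (n.+2 * n.+2)%:R * 3 ^+ n * K * (2 * n.+1%:R) `^ gamma : R.
have c0 : 0 < c by rewrite /c !mulr_gt0 ?powR_gt0 ?exprn_gt0 ?mulr_gt0// ltr0n.
have e0 : 0 < eps / K / c by rewrite !divr_gt0.
have : \forall a \near (0 : R)^'+, a `^ (gamma - n%:R) < eps / K / c.
  apply: (cvgr_lt 0) => //; apply: powR_cvg0; by rewrite subr_gt0.
move=> [delta /= delta0 Hdelta].
(* The first entry keeps doubled covering radii within [r]; the second puts [M^-1] below [delta]. *)
pose M := maxn (2 * n.+1) (Num.bound delta^-1).
have M0 : (0 < M)%N by rewrite /M leq_max mulnS addSn.
have M0' : 0 < M%:R :> R by rewrite ltr0n.
have small : M%:R^-1 `^ (gamma - n%:R) < eps / K / c.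
  apply: Hdelta => /=; rewrite ?invr_gt0// sub0r normrN ger0_norm ?invr_ge0//.
  rewrite invf_plt ?posrE//; apply: lt_le_trans (archi_boundP _) _.
    by rewrite invr_ge0 ltW.
  by rewrite ler_nat leq_maxr.
exists M; split => //; first by rewrite -natrM ler_nat leq_maxl.
rewrite card_prod card_ffun !card_ord.
have grid_le : ((2 * M).+1 ^ n)%:R <= 3 ^+ n * M%:R ^+ n :> R.
  rewrite -exprMn natrX lerXn2r ?nnegrE ?mulr_ge0// -natrM ler_nat.
  by rewrite -addn1 (mulnDl 2 1 M) leq_add2l mul1n.
have pw (a : R) : 0 < a -> a ^+ n * a `^ (gamma - n%:R) = a `^ gamma.
  move=> a0; rewrite -powR_mulrn ?(ltW a0)// -powRD ?(gt_eqF a0) ?implybT//.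
  by rewrite addrC subrK.
have -> : (2 * (n.+1%:R / M%:R)) `^ gamma = (2 * n.+1%:R) `^ gamma *
    (M%:R^-1 ^+ n * M%:R^-1 `^ (gamma - n%:R)) :> R.
  rewrite (mulrA 2) [LHS]powRM ?invr_ge0 ?mulr_ge0//; congr (_ * _).
  by rewrite pw ?invr_gt0.
set p := M%:R^-1 `^ _ in small *.
have p0 : 0 <= p by exact: powR_ge0.
apply: (@le_trans _ _ (c * p)); last first.
  by rewrite mulrC -ler_pdivlMr// ltW.
rewrite [leRHS](_ : _ = (n.+2 * n.+2)%:R * ((3 ^+ n * M%:R ^+ n) *
  (K * ((2 * n.+1%:R) `^ gamma * (M%:R^-1 ^+ n * p))))); last first.
  by rewrite /c exprVn; field; rewrite expf_neq0 ?gt_eqF.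
rewrite ler_pM2l ?ltr0n// ler_wpM2r//.
by rewrite !mulr_ge0 ?powR_ge0 ?exprn_ge0 ?invr_ge0 ?(ltW K0).
Qed.

Lemma measurable_Uset (R : realType) (H : normedModType R) (ip : {dot H for idfun})
    (n : nat) (C : R) (v : 'I_n.+2 -> H) (w : H) :
  induces_norm ip -> 0 < C -> measurable (Uset ip C v w : set (borelType H)).
Proof.
move=> ip_norm C0; rewrite -[Uset ip C v w]setCK UsetC; apply: measurableC.
apply: fin_bigcup_measurable => // -[i j] ij.
by apply: measurable_bad_pair => //; rewrite neq_ltn [(i < j)%N]ij.
Qed.

Lemma measure_Uset_compl (R : realType) (H : normedModType R) (ip : {dot H for idfun})
    (mu : {measure set (borelType H) -> \bar R}) (supp : set H) (gamma K : R)
    (n M : nat) (v : 'I_n.+2 -> H) (w : H) (C r : R) :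
  induces_norm ip -> is_support mu supp -> ahlfors_constant mu gamma supp K ->
  (0 < M)%N -> 2 * n.+1%:R <= M%:R :> R -> M%:R <= C ->
  0 < r -> (r%:E <= diam supp)%E ->
  (mu (cball w r `\` Uset ip C v w) <=
    (#|{: 'I_n.+2 * 'I_n.+2}|%:R * (#|{ffun 'I_n -> 'I_(2 * M).+1}|%:R *
      (K * (2 * (n.+1%:R * (r / M%:R))) `^ gamma)))%:E)%E.
Proof.
move=> ip_norm Hsupp HK M0 nM MC r0 rdiam.
have M0' : 0 < M%:R :> R by rewrite ltr0n.
have C0 : 0 < C by exact: lt_le_trans MC.
have mball x s : measurable (cball x s : set (borelType H)).
  by apply: closed_borel; exact: closed_closed_ball_.
(* Pairs that are not increasing get the empty set, so that the union runs over a whole finite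
   type. *)
pose F (p : 'I_n.+2 * 'I_n.+2) : set (borelType H) :=
  if (p.1 < p.2)%N then bad_pair ip C v w p.1 p.2 `&` cball w r else set0.
have mbad (p : 'I_n.+2 * 'I_n.+2) : (p.1 < p.2)%N ->
    measurable (bad_pair ip C v w p.1 p.2 : set (borelType H)).
  by move=> p12; apply: measurable_bad_pair; rewrite // neq_ltn p12.
apply: (measure_finite_cover (F := F)).
- by apply: measurableD => //; exact: measurable_Uset.
- by move=> p; rewrite /F; case: ifP => [/mbad ?|_] //; exact: measurableI.
- rewrite setDE UsetC => u [wu [p p12 bad]]; exists p => //.
  by rewrite /F p12.
move=> p; rewrite /F; case: ifPn => [p12|_]; last first.
  by rewrite measure0 lee_fin !mulr_ge0// ?powR_ge0// ltW//; case: HK.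
have pne : p.1 != p.2 by rewrite neq_ltn p12.
have [f fcover] := bad_pair_cover ip_norm w v pne.
apply: (measure_finite_cover (F := fun g : {ffun 'I_n -> 'I_(2 * M).+1} =>
  cball (w + grid_point f r g) (n.+1%:R * (r / M%:R)) : set (borelType H))).
- by apply: measurableI => //; exact: mbad.
- by move=> g; exact: mball.
- exact: fcover.
move=> g; apply: measure_cball_le Hsupp HK _ _.
  by rewrite !mulr_gt0// invr_gt0.
apply: le_trans rdiam; rewrite lee_fin mulrA mulrCA -[leRHS]mulr1 ler_pM2l//.
by rewrite ler_pdivrMr// mul1r.
Qed.

Theorem theorem1p2 (R : realType) (d : nat) (eps gamma K : R)
    (hd : (2 <= d)%N) (heps0 : 0 < eps) (heps1 : eps < 1)
    (hgamma1 : d%:R - 1 < gamma) (hgamma2 : gamma <= d%:R) (hK : 0 < K) :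
  exists C0 : R, 1 <= C0 /\
    forall (H : normedModType R) (ip : {dot H for idfun}),
      induces_norm ip -> dim_ge H d.+1 ->
    forall (mu : {measure set (borelType H) -> \bar R}) (supp : set H),
      is_support mu supp ->
      ahlfors_regular mu gamma supp ->
      is_regularity_constant mu gamma supp K ->
    forall w : H, supp w ->
    forall (v : 'I_d.+1 -> H) (C : R), C0 <= C ->
    forall r : R, 0 < r -> (r%:E <= diam supp)%E ->
      ((1 - eps)%:E <= mu (Uset ip C v w `&` cball w r) / mu (cball w r))%E.
Proof.
(* With [d = n + 1], the planes have dimension [n] and the hypothesis on [gamma] reads
   [n < gamma]. *)
case: d hd hgamma1 hgamma2 => [//|n] _; rewrite -natr1 addrK => ngamma _.
have [M [M0 nM Msmall]] := tube_constant heps0 ngamma hK.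
exists M%:R; split; first by rewrite ler1n.
move=> H ip ip_norm _ mu supp Hsupp _ [HK _] w wsupp v C MC r r0 rdiam.
have mball : measurable (cball w r : set (borelType H)).
  by apply: closed_borel; exact: closed_closed_ball_.
have C0 : 0 < C by apply: lt_le_trans MC; rewrite ltr0n.
have mU : measurable (Uset ip C v w : set (borelType H)).
  exact: measurable_Uset.
have [lb ub] := HK.2 w r wsupp r0 rdiam.
have bad_le : (mu (cball w r `\` Uset ip C v w) <= (eps / K * r `^ gamma)%:E)%E.
  apply: le_trans (measure_Uset_compl v w ip_norm Hsupp HK M0 nM MC r0 rdiam) _.
  rewrite lee_fin; apply: le_trans (ler_wpM2r (powR_ge0 r gamma) Msmall).
  rewrite (_ : 2 * (_ * (r / _)) = 2 * (n.+1%:R / M%:R) * r); last by ring.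
  by rewrite powRM ?(ltW r0) ?mulr_ge0 ?divr_ge0// !mulrA.
(* Finiteness of the three measures moves the rest to real arithmetic. *)
have ball_fin : mu (cball w r) \is a fin_num.
  by rewrite ge0_fin_numE// (le_lt_trans ub)// ltry.
have bad_fin : mu (cball w r `\` Uset ip C v w) \is a fin_num.
  by rewrite ge0_fin_numE// (le_lt_trans bad_le)// ltry.
have good_fin : mu (cball w r `&` Uset ip C v w) \is a fin_num.
  rewrite ge0_fin_numE//; apply: le_lt_trans (_ : mu (cball w r) < +oo)%E.
    by apply: le_measure; rewrite ?inE//; exact: measurableI.
  by rewrite -ge0_fin_numE.
have bE : fine (mu (cball w r)) = fine (mu (cball w r `\` Uset ip C v w)) +
    fine (mu (cball w r `&` Uset ip C v w)).
  by rewrite -fineD// -measureDI.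
rewrite (setIC (Uset _ _ _ _)).
move: lb bad_le; rewrite -(fineK ball_fin) -(fineK bad_fin) -(fineK good_fin).
rewrite !lee_fin.
set b := fine _ in bE *; set x := fine _ in bE *; set y := fine _ in bE * => lb xle.
have b0 : 0 < b by apply: lt_le_trans lb; rewrite mulr_gt0 ?invr_gt0// powR_gt0.
rewrite inver gt_eqF// -EFinM lee_fin ler_pdivlMr//.
(* The lower regularity bound at [w] gives [x <= eps * b]; with [b = x + y] the claim follows. *)
have : eps * (K^-1 * r `^ gamma) <= eps * b by rewrite ler_pM2l.
by rewrite mulrA => h; nra.
Qed.
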